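(* Let $k$ be a positive integer, $G=C_{3k+2}$, and let $G_1,G_2$ be disjoint copies of $G$ whose vertices are each labeled $1,\dots,3k+2$ cyclically. Let $f:V(G_1)\to V(G_2)$ be a bijection such that $d_{G_2}(f(x),f(y))\equiv 1\pmod 3$ whenever $d_{G_1}(x,y)\equiv 1\pmod 3$. If $f(1)=1$, then $C(C_{3k+2},f)\cong C_{3k+2}\times K_2$.
   Context: For disjoint copies $G_1,G_2$ of a graph $G$ and a function $f:V(G_1)\to V(G_2)$, the functigraph $C(G,f)$ has vertex set $V(G_1)\cup V(G_2)$ and edge set $E(G_1)\cup E(G_2)\cup\{uv : u\in V(G_1), v\in V(G_2), v=f(u)\}$. $d_{G_i}(x,y)$ is the distance in the cycle $G_i$; $C_{3k+2}\times K_2$ is the Cartesian product (prism). *)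

(* Defs.v *)
From mathcomp Require Import all_boot.

Set Implicit Arguments.
Unset Strict Implicit.
Unset Printing Implicit Defensive.

(** A simple graph is given by its adjacency relation, a
    symmetric irreflexive [rel] on a [finType] of vertices. *)

Section Graphs.
Variable T : finType.
Implicit Types (e : rel T) (x y : T).

Definition walk_of_length e x y (m : nat) : bool :=
  [exists p : m.-tuple T, path e x p && (last x p == y)].

(** When [y] is reachable from [x], some walk has length less than [#|T|], so the
    bounded search is exact; otherwise the (junk) value is [#|T|]. *)
Definition gdist e x y : nat := find (walk_of_length e x y) (iota 0 #|T|).

Lemma gdist_le e x p : path e x p -> gdist e x (last x p) <= size p.
Proof.
move=> ep; have [lt_p|] := ltnP (size p) #|T|; last first.
  by apply: leq_trans; rewrite -[leqRHS](size_iota 0) find_size.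
rewrite leqNgt; apply/negP => /(before_find 0).
rewrite nth_iota // add0n => /existsP[]; exists (in_tuple p).
by rewrite ep eqxx.
Qed.

Lemma gdist_walk e x y : connect e x y ->
  exists p, [/\ path e x p, last x p = y & size p = gdist e x y].
Proof.
case/connectP=> p ep ->; case/shortenP: ep => q eq_q uq _.
have lt_q : size q < #|T|.
  by rewrite -[(size q).+1]/(size (x :: q)) -(card_uniqP uq) max_card.
have hw : has (walk_of_length e x (last x q)) (iota 0 #|T|).
  apply/hasP; exists (size q); first by rewrite mem_iota.
  by apply/existsP; exists (in_tuple q); rewrite eq_q eqxx.
have := nth_find 0 hw; rewrite has_find size_iota in hw.
rewrite nth_iota // add0n => /existsP[r /andP[er /eqP lr]].
by exists r; rewrite size_tuple.
Qed.

(** [inl] and [inr] are the two disjoint copies of the vertex set. *)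
Definition functigraph e (f : T -> T) : rel (T + T) := fun u v =>
  match u, v with
  | inl x, inl y => e x y
  | inr x, inr y => e x y
  | inl x, inr y => y == f x
  | inr y, inl x => y == f x
  end.

End Graphs.

(** The cycle with vertices labelled [0, ..., n-1]; simple for [n >= 3]. *)
Definition cycle_graph n : rel 'I_n :=
  fun i j => (j == ordS i) || (i == ordS j).

Definition complete_graph n : rel 'I_n := fun i j => i != j.

Definition cartesian_product (T1 T2 : finType) (e1 : rel T1) (e2 : rel T2) :
    rel (T1 * T2) := fun u v =>
  ((u.1 == v.1) && e2 u.2 v.2) || ((u.2 == v.2) && e1 u.1 v.1).

Definition graph_iso (T1 T2 : finType) (e1 : rel T1) (e2 : rel T2) : Prop :=
  exists h : T1 -> T2, bijective h /\ forall x y, e2 (h x) (h y) = e1 x y.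

Lemma cycle_graph_sym n : symmetric (@cycle_graph n).
Proof. by move=> i j; rewrite /cycle_graph orbC. Qed.

Lemma cycle_graph_irr n : 1 < n -> irreflexive (@cycle_graph n).
Proof.
move=> n_gt1 i; rewrite /cycle_graph orbb; apply/eqP => /(congr1 val) /= Ei.
have := ltn_ord i; rewrite leq_eqVlt => /predU1P[Si|lt_i].
  by rewrite Si modnn in Ei; rewrite Ei in Si; rewrite -Si in n_gt1.
by move: Ei; rewrite modn_small // => /eqP; rewrite -[X in X == _]addn0 -addn1 eqn_add2l.
Qed.

(* Main.v *)
(** Two vertices of C_n, n = 3k+2, are at distance 1 mod 3 exactly when their
    difference in Z_n is 1 mod 3, so f is an injective endomorphism of the Andrasfai
    graph on Z_n.  After dividing by 3, which is a unit with inverse k+1, the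
    neighbours of u are the u + t with k < t <= 2k+1.  Consecutive vertices have k
    common neighbours, while all other pairs of distinct vertices have fewer;
    hence the endomorphism maps consecutive vertices to consecutive vertices.  As it
    fixes 0, it is u |-> u or u |-> -u; so f is an automorphism of the cycle, and
    applying f to the first copy turns the functigraph into the prism. *)
Require Import Defs.
From mathcomp Require Import all_boot.
From mathcomp Require Import ssralg zmodp.
From mathcomp Require Import zify ring.

Set Implicit Arguments.
Unset Strict Implicit.
Unset Printing Implicit Defensive.

Import GRing.Theory.

(** * Residues in Z_n, distances in the cycle, and the prism *)

Section Zn.
Local Open Scope ring_scope.
Variable n : nat.
Implicit Types x y z : 'I_n.+2.

Lemma val_subZ x y :
  (x - y : 'I_n.+2) = (if y <= x then x - y else x + n.+2 - y)%N :> nat.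
Proof.
have [lt_x lt_y] := (ltn_ord x, ltn_ord y).
rewrite /= modnDmr; case: leqP => le_yx.
  have -> : (x + (n.+2 - y) = (x - y) + n.+2)%N by lia.
  by rewrite modnDr modn_small //; lia.
by rewrite modn_small; lia.
Qed.

Lemma val_succZ x : (x + 1 : 'I_n.+2) = (if x == n.+1 :> nat then 0 else x.+1)%N :> nat.
Proof.
have lt_x := ltn_ord x; rewrite /= modnDmr addn1.
by case: eqP => [->|ne_x]; rewrite ?modnn // modn_small //; lia.
Qed.

Lemma val_natZ m : (m%:R : 'I_n.+2) = (m %% n.+2)%N :> nat.
Proof. exact: (@val_Zp_nat n.+2). Qed.

Lemma natZ_val x : (x : nat)%:R = x.
Proof. exact: natr_Zp. Qed.

Lemma natZ_char : n.+2%:R = 0 :> 'I_n.+2.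
Proof. by apply: ord_inj; rewrite val_natZ modnn. Qed.

Lemma ordSE x : ordS x = x + 1.
Proof. by apply/val_inj; rewrite /= modnDmr addn1. Qed.

Lemma cycle_graphE x y : cycle_graph x y = (y == x + 1) || (x == y + 1).
Proof. by rewrite /cycle_graph !ordSE. Qed.

Lemma card_ord_interval (A : {set 'I_n.+2}) (a b : nat) :
  (forall x, x \in A -> (a <= x < b)%N) -> (#|A| <= b - a)%N.
Proof.
move=> sA; rewrite cardE -(size_map val) -(size_iota a (b - a)).
apply: uniq_leq_size; first by rewrite (map_inj_uniq val_inj) enum_uniq.
by move=> _ /mapP[x xA ->]; rewrite mem_enum in xA; have := sA x xA; rewrite mem_iota /=; lia.
Qed.

Lemma cycle_walk_up x m :
  exists p, [/\ path (@cycle_graph n.+2) x p, last x p = x + m%:R & size p = m].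
Proof.
elim: m x => [|m IHm] x; first by exists [::]; rewrite addr0.
have [p [ep lp sp]] := IHm (x + 1); exists (x + 1 :: p); split => /=.
- by rewrite ep cycle_graphE eqxx.
- by rewrite lp -addrA -mulrS.
- by rewrite sp.
Qed.

Lemma cycle_walk_down x m :
  exists p, [/\ path (@cycle_graph n.+2) x p, last x p = x - m%:R & size p = m].
Proof.
elim: m x => [|m IHm] x; first by exists [::]; rewrite subr0.
have [p [ep lp sp]] := IHm (x - 1); exists (x - 1 :: p); split => /=.
- by rewrite ep cycle_graphE subrK eqxx orbT.
- by rewrite lp -addrA -opprD -mulrS.
- by rewrite sp.
Qed.

(** Lower bound for the distance: an edge moves the difference to the endpoint by one in Z_n, so the
    shorter arc shrinks by at most one per step. *)
Lemma cycle_walk_size x p : path (@cycle_graph n.+2) x p ->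
  (minn (last x p - x)%R (n.+2 - (last x p - x)%R) <= size p)%N.
Proof.
elim: p x => [|y p IHp] x; first by rewrite [last _ _]/= subrr min0n.
rewrite [path _ _ _]/= [last _ _]/= => /andP[]; rewrite cycle_graphE => exy /IHp.
move: (last y p) => z.
have := ltn_ord x; have := ltn_ord y; have := ltn_ord z.
by case/orP: exy => /eqP ->; rewrite !val_subZ !val_succZ [size (_ :: _)]/=;
  do ![case: ifP => ?]; rewrite ?leq0n; lia.
Qed.

Lemma gdist_cycle x y :
  gdist (@cycle_graph n.+2) x y = minn (y - x)%R (n.+2 - (y - x)%R).
Proof.
have lt_d := ltn_ord (y - x).
have [p [ep lp sp]] := cycle_walk_up x (y - x)%R.
have [q [eq_q lq sq]] := cycle_walk_down x (n.+2 - (y - x)%R)%N.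
have {}lp : last x p = y by rewrite lp natZ_val addrC subrK.
have {}lq : last x q = y.
  by rewrite lq natrB 1?ltnW // natZ_char natZ_val; ring.
apply/eqP; rewrite eqn_leq; apply/andP; split.
  have := gdist_le ep; have := gdist_le eq_q; rewrite lp lq sp sq; lia.
have [|r [er lr sr]] := @gdist_walk _ (@cycle_graph n.+2) x y.
  by apply/connectP; exists p.
by rewrite -sr -{1 2}lr; apply: cycle_walk_size.
Qed.

(** Relabelling the first copy by [f] turns the cross edge at [x] into the rung over [f x]. *)
Lemma cycle_auto_iso (f : 'I_n.+2 -> 'I_n.+2) :
  bijective f -> (forall x y, cycle_graph (f x) (f y) = cycle_graph x y) ->
  graph_iso (functigraph (@cycle_graph n.+2) f)
            (cartesian_product (@cycle_graph n.+2) (@complete_graph 2)).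
Proof.
move=> [f' fK f'K] fE.
pose h (u : 'I_n.+2 + 'I_n.+2) : 'I_n.+2 * 'I_2 :=
  match u with inl x => (f x, ord0) | inr y => (y, ord_max) end.
pose h' (v : 'I_n.+2 * 'I_2) : 'I_n.+2 + 'I_n.+2 :=
  if v.2 == ord0 then inl (f' v.1) else inr v.1.
exists h; split.
  exists h'; first by case=> x; rewrite /h' /h //= fK.
  case=> x [[|[|//]] lt_i]; rewrite /h' /h /= ?f'K; congr pair; exact: val_inj.
by case=> x [] y; rewrite /cartesian_product /complete_graph /= ?andbF ?andbT ?orbF //= eq_sym.
Qed.

End Zn.

(** * Injective endomorphisms of the Andrasfai graph *)

Section Andrasfai.
Local Open Scope ring_scope.
Variable k : nat.
Hypothesis k_gt0 : (0 < k)%N.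
Local Notation N := (3 * k).+2.
Implicit Types u v w x y : 'I_N.

(** The interval is stable under [t |-> N - t], so this is symmetric despite the oriented
    difference. *)
Definition nbr u v := (k < (v - u)%R <= (2 * k).+1)%N.

Lemma nbr_common_succ u : (k <= #|[set w | nbr u w && nbr (u + 1)%R w]|)%N.
Proof.
(* The offsets k+2, ..., 2k+1 are the overlap of the interval k+1, ..., 2k+1 with its shift by
   one. *)
pose g (j : 'I_k) := u + (k.+2 + j)%:R.
have val_small m : (m < N)%N -> (m%:R : 'I_N) = m :> nat.
  by move=> lt_m; rewrite val_natZ modn_small.
have g_inj : injective g.
  move=> i j /addrI /(congr1 (@nat_of_ord _)).
  have [lt_i lt_j] := (ltn_ord i, ltn_ord j).
  by rewrite !val_small; [move=> ?; apply: val_inj => /= | | ]; lia.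
rewrite -[X in (X <= _)%N]card_ord -(card_imset _ g_inj).
apply/subset_leq_card/subsetP => _ /imsetP[j _ ->]; have lt_j := ltn_ord j.
rewrite inE /nbr.
have -> : g j - u = (k.+2 + j)%:R by rewrite /g; ring.
have -> : g j - (u + 1) = (k.+1 + j)%:R by rewrite /g addSn mulrS; ring.
by rewrite !val_small; lia.
Qed.

(** Here [d = v - u] satisfies 2 <= d <= 3k, and an interval of k+1 residues meets its shift by [d]
    in at most k-1 places. *)
Lemma nbr_common_far u v : u != v -> v != u + 1 -> v != u - 1 ->
  (#|[set w | nbr u w && nbr v w]| < k)%N.
Proof.
set A := [set w | _] => uv vS vP; pose d := v - u.
have dE : v = u + d by rewrite /d; ring.
have lt_d := ltn_ord d.
have d0 : (d : nat) != 0%N.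
  by apply: contraNneq uv => d0; rewrite dE -[d]natZ_val d0 addr0.
have d1 : (d : nat) != 1%N.
  by apply: contraNneq vS => d1; rewrite dE -[d]natZ_val d1.
have dm1 : (d : nat) != (3 * k).+1.
  apply: contraNneq vP => dm1; rewrite dE -[d]natZ_val dm1.
  have := natZ_char (3 * k); rewrite mulrS => /eqP.
  by rewrite addrC addr_eq0 => /eqP ->.
have inj_sub : injective (fun w => w - u) by exact: addIr.
rewrite -(card_imset A inj_sub).
have inA t : t \in (fun w => w - u) @: A ->
    (k < t <= (2 * k).+1)%N && (k < (if d <= t then t - d else t + N - d) <= (2 * k).+1)%N.
  case/imsetP=> w wA {t}->; move: wA; rewrite inE /nbr.
  have -> : w - v = (w - u) - d by rewrite dE; ring.
  by rewrite (val_subZ (w - u) d).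
rewrite [X in (_ < X)%N](_ : k = k.-1.+1); last lia.
rewrite ltnS.
(* For d <= 2k+1 the overlap involves no wrap-around and has at most k+1-d elements; for larger [d]
   it is entirely due to wrap-around and has at most d-2k-1. *)
have [le_d|lt_kd] := leqP d (2 * k).+1.
  apply: leq_trans (_ : ((2 * k).+2 - (d + k.+1) <= _)%N); last by lia.
  by apply: card_ord_interval => t /inA; have := ltn_ord t; case: ifP; lia.
apply: leq_trans (_ : ((d - k) - k.+1 <= _)%N); last by lia.
by apply: card_ord_interval => t /inA; have := ltn_ord t; case: ifP; lia.
Qed.

(** By injectivity, the images of the common neighbours of [u] and [u + 1] give [g u] and
    [g (u + 1)] at least [k] common neighbours. *)
Lemma nbr_endo_succ (g : 'I_N -> 'I_N) u : injective g ->
  (forall u v, nbr u v -> nbr (g u) (g v)) ->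
  g (u + 1) = g u + 1 \/ g (u + 1) = g u - 1.
Proof.
move=> g_inj gE.
have [->|n1] := eqVneq (g (u + 1)) (g u + 1); first by left.
have [->|n2] := eqVneq (g (u + 1)) (g u - 1); first by right.
have n0 : g u != g (u + 1).
  apply: contra_eq_neq (oner_neq0 'I_N) => /g_inj.
  by rewrite -[X in X = _]addr0 => /addrI ->.
have := nbr_common_far n0 n1 n2; rewrite ltnNge => /negP[].
apply: leq_trans (nbr_common_succ u) _; rewrite -(card_imset _ g_inj).
apply/subset_leq_card/subsetP => _ /imsetP[w + ->].
by rewrite !inE => /andP[/gE -> /gE ->].
Qed.

Lemma nbr_endo_linear (g : 'I_N -> 'I_N) : injective g -> g 0 = 0 ->
  (forall u v, nbr u v -> nbr (g u) (g v)) ->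
  exists2 e, e = 1 \/ e = -1 & forall u, g u = e * u.
Proof.
move=> g_inj g0 gE.
have step u := nbr_endo_succ u g_inj gE.
have two0 : 2%:R != 0 :> 'I_N.
  by apply/eqP => /(congr1 (@nat_of_ord _)); rewrite val_natZ modn_small //=; lia.
have e1 : g 1 = 1 \/ g 1 = -1 by have := step 0; rewrite g0 !add0r.
exists (g 1) => // u; rewrite -[u]natZ_val.
(* Carrying two consecutive values records the direction of the last step; turning back would
   contradict injectivity, since 2 is nonzero. *)
suff [] : g (u : nat)%:R = g 1 * (u : nat)%:R /\ g (u.+1)%:R = g 1 * (u.+1)%:R by [].
elim: {u}(u : nat) => [|m [IH1 IH2]]; first by rewrite g0 !mulr0 mulr1.
split=> //.
have back : g m.+2%:R <> g m%:R.
  move=> /g_inj /eqP; rewrite -subr_eq0 !mulrS.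
  by have -> : 1 + (1 + m%:R) - m%:R = 2%:R :> 'I_N; [ring | exact/negP].
have := step m.+1%:R; rewrite -mulrSr IH2 => -[] sg; move: back; rewrite sg IH1;
  case: e1 => ->; rewrite !mulrS => back; try ring; case: back; ring.
Qed.

Lemma three_unit : k.+1%:R * 3%:R = 1 :> 'I_N.
Proof.
rewrite -natrM; have -> : (k.+1 * 3 = N.+1)%N by lia.
by rewrite mulrS natZ_char addr0.
Qed.

(** Reducing 3w modulo N subtracts N zero, one or two times. As N is 2 mod 3, the result is 0, 1 or
    2 mod 3 respectively, and the middle case is k < w <= 2k+1. *)
Lemma nbr_triple u v : nbr u v = ((3%:R * v - 3%:R * u)%R %% 3 == 1)%N.
Proof.
rewrite -mulrBr /nbr -[in RHS](natZ_val (v - u)) -natrM val_natZ.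
have := ltn_ord (v - u); move: (nat_of_ord (v - u)) => w lt_w.
have [le_w|lt_kw] := leqP w k; first by rewrite (@modn_small _ N); lia.
have [le_w|lt_2kw] := leqP w (2 * k).+1.
  have -> : (3 * w = (3 * w - N) + N)%N by lia.
  by rewrite (@modnDr _ N) (@modn_small _ N); lia.
have -> : (3 * w = (3 * w - N - N) + N + N)%N by lia.
by rewrite 2!(@modnDr _ N) (@modn_small _ N); lia.
Qed.

Lemma mod3_endo_cycle_auto (f : 'I_N -> 'I_N) : injective f -> f 0 = 0 ->
  (forall x y, ((y - x)%R %% 3 == 1)%N -> ((f y - f x)%R %% 3 == 1)%N) ->
  forall x y, cycle_graph (f x) (f y) = cycle_graph x y.
Proof.
move=> f_inj f0 fE.
have tu := three_unit; have tu' : 3%:R * k.+1%:R = 1 :> 'I_N by rewrite mulrC.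
(* Conjugating by multiplication by 3 turns [f] into an endomorphism for [nbr]; a linear [g] then
   gives [f] the same coefficient. *)
pose g u := k.+1%:R * f (3%:R * u).
have g3 u : 3%:R * g u = f (3%:R * u) by rewrite /g mulrA tu' mul1r.
have g_inj : injective g.
  move=> u v /(congr1 ( *%R 3%:R)); rewrite !g3 => /f_inj /(congr1 ( *%R k.+1%:R)).
  by rewrite !mulrA tu !mul1r.
have g0 : g 0 = 0 by rewrite /g mulr0 f0 mulr0.
have gE u v : nbr u v -> nbr (g u) (g v).
  by rewrite !nbr_triple !g3 => /fE.
have [e e1 ge] := nbr_endo_linear g_inj g0 gE.
have fe x : f x = e * x.
  by rewrite -[x]mul1r -tu' -mulrA -g3 ge; ring.
have oppE x y : (- x == - y + 1) = (y == x + 1).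
  by rewrite -subr_eq0 -[RHS]subr_eq0; congr (_ == 0); ring.
move=> x y; rewrite !cycle_graphE !fe.
by case: e1 => ->; rewrite ?mul1r // !mulN1r !oppE orbC.
Qed.

(** As n = 2 mod 3, the lengths d and n - d of the two arcs are simultaneously 1
    mod 3, so it does not matter which of them is the shorter. *)
Lemma gdist_cycle_mod3 x y :
  (gdist (@cycle_graph N) x y = 1 %[mod 3]) <-> ((y - x)%R %% 3 == 1)%N.
Proof. by rewrite gdist_cycle; have := ltn_ord (y - x); split; lia. Qed.

End Andrasfai.

Theorem theorem4p8 (k : nat) (f : 'I_(3 * k).+2 -> 'I_(3 * k).+2) :
  0 < k ->
  bijective f ->
  (forall x y : 'I_(3 * k).+2,
     gdist (@cycle_graph (3 * k).+2) x y = 1 %[mod 3] ->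
     gdist (@cycle_graph (3 * k).+2) (f x) (f y) = 1 %[mod 3]) ->
  f ord0 = ord0 ->
  graph_iso (functigraph (@cycle_graph (3 * k).+2) f)
            (cartesian_product (@cycle_graph (3 * k).+2) (@complete_graph 2)).
Proof.
move=> k_gt0 f_bij fE f0; apply: cycle_auto_iso => //.
apply: (mod3_endo_cycle_auto k_gt0 (bij_inj f_bij) f0).
by move=> x y xy1; apply/gdist_cycle_mod3/fE/gdist_cycle_mod3.
Qed.
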